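(* Let $m,\ell$ be nonzero integers with $m\neq\ell$ and let $i,j$ be integers with $m\nmid i$ and $\ell\nmid j$. Then in the group $BS(m,\ell)$, $$\operatorname{scl}(ta^it^{-1}a^j)\ =\ \frac12\left(1-\frac{\gcd(i,m)}{|m|}-\frac{\gcd(j,\ell)}{|\ell|}\right).$$
   Context: $BS(m,\ell)=\langle a,t\mid t a^m t^{-1}=a^{\ell}\rangle$. Greatest common divisors are taken positive. Stable commutator length in a group $G$: for $g\in[G,G]$, $\operatorname{scl}(g)=\lim_{n\to\infty}\operatorname{cl}(g^n)/n$, where $\operatorname{cl}$ is the least number of commutators whose product is the given element; if $g^k\in[G,G]$ for some $k\ge1$, $\operatorname{scl}(g)=\operatorname{scl}(g^k)/k$; otherwise $\operatorname{scl}(g)=\infty$. *)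

(* Defs.v *)
From HB Require Import structures.
From mathcomp Require Import all_boot all_order all_algebra.
From mathcomp Require Import all_classical all_reals all_analysis.

Set Implicit Arguments.
Unset Strict Implicit.
Unset Printing Implicit Defensive.

Import Order.TTheory GRing.Theory Num.Theory.
Import numFieldNormedType.Exports.

(* Groups given by a presentation: words in the letters x and x^-1, modulo    *)
(* the congruence generated by free cancellation and the given relations.     *)
Section Presentation.
Variable X : choiceType.

(* The letter (x, false) stands for x, and (x, true) for its inverse. *)
Notation word := (seq (X * bool)).

Definition inv_letter (c : X * bool) : X * bool := (c.1, ~~ c.2).
Definition inv_word (w : word) : word := rev (map inv_letter w).

Definition wordz (x : X) (n : int) : word := nseq `|n|%N (x, (n < 0)%R).

Variable rels : word -> word -> Prop.

Inductive pres_eq : word -> word -> Prop :=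
| pres_rel u v : rels u v -> pres_eq u v
| pres_cancel c : pres_eq [:: c; inv_letter c] [::]
| pres_cat u u' v v' : pres_eq u u' -> pres_eq v v' ->
    pres_eq (u ++ v) (u' ++ v')
| pres_refl u : pres_eq u u
| pres_sym u v : pres_eq u v -> pres_eq v u
| pres_trans u v w : pres_eq u v -> pres_eq v w -> pres_eq u w.

Definition pres_eqb (u v : word) : bool := `[< pres_eq u v >].

Lemma pres_eqb_refl : reflexive pres_eqb.
Proof. by move=> u; apply/asboolP; exact: pres_refl. Qed.

Lemma pres_eqb_sym : symmetric pres_eqb.
Proof. by move=> u v; apply/asboolP/asboolP; exact: pres_sym. Qed.

Lemma pres_eqb_trans : transitive pres_eqb.
Proof.
by move=> v u w /asboolP uv /asboolP vw; apply/asboolP; exact: pres_trans uv vw.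
Qed.

Canonical pres_equiv :=
  EquivRel pres_eqb pres_eqb_refl pres_eqb_sym pres_eqb_trans.

Definition presented : Type := {eq_quot pres_eqb}%qT.
HB.instance Definition _ := Choice.on presented.
HB.instance Definition _ := Quotient.on presented.

Local Open Scope quotient_scope.

Definition pres_class (w : word) : presented := \pi_presented w.
Definition pres_one : presented := pres_class [::].
Definition pres_mul (g h : presented) : presented :=
  pres_class (repr g ++ repr h).
Definition pres_inv (g : presented) : presented :=
  pres_class (inv_word (repr g)).
Definition pres_gen (x : X) : presented := pres_class [:: (x, false)].

Lemma pres_classP u v : pres_class u = pres_class v <-> pres_eq u v.
Proof.
split=> [/eqquotP/asboolP //|uv].
by apply/eqquotP/asboolP.
Qed.

Lemma pres_reprK w : pres_eq (repr (pres_class w)) w.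
Proof. by apply/pres_classP; rewrite /pres_class reprK. Qed.

Lemma pres_mulE u v :
  pres_mul (pres_class u) (pres_class v) = pres_class (u ++ v).
Proof. by apply/pres_classP; apply: pres_cat; exact: pres_reprK. Qed.

Lemma inv_letterK : involutive inv_letter.
Proof. by case=> x b; rewrite /inv_letter /= negbK. Qed.

Lemma inv_wordK : involutive inv_word.
Proof. by move=> w; rewrite /inv_word map_rev revK (mapK inv_letterK). Qed.

Lemma pres_wordV w : pres_eq (w ++ inv_word w) [::].
Proof.
elim: w => [|c w IHw]; first exact: pres_refl.
rewrite /inv_word /= rev_cons -cats1 catA -/(inv_word w).
apply: pres_trans (pres_cancel c).
rewrite -[_ :: _]/([:: c] ++ ((w ++ inv_word w) ++ [:: inv_letter c])).
apply: (@pres_cat _ [:: c] _ [:: inv_letter c]); first exact: pres_refl.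
by apply: (@pres_cat _ [::]); [exact: IHw | exact: pres_refl].
Qed.

Lemma pres_Vword w : pres_eq (inv_word w ++ w) [::].
Proof. by rewrite -{2}[w]inv_wordK; exact: pres_wordV. Qed.

Lemma pres_mulA : associative pres_mul.
Proof.
move=> x y z; rewrite -[x]reprK -[y]reprK -[z]reprK.
by rewrite -!/(pres_class _) !pres_mulE catA.
Qed.

Lemma pres_mul1g : left_id pres_one pres_mul.
Proof. by move=> x; rewrite -[x]reprK -/(pres_class _) pres_mulE. Qed.

Lemma pres_mulg1 : right_id pres_one pres_mul.
Proof. by move=> x; rewrite -[x]reprK -/(pres_class _) pres_mulE cats0. Qed.

Lemma pres_mulVg : left_inverse pres_one pres_inv pres_mul.
Proof.
move=> x; rewrite -{2}[x]reprK -/(pres_class _).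
rewrite /pres_inv pres_mulE; apply/pres_classP; exact: pres_Vword.
Qed.

Lemma pres_mulgV : right_inverse pres_one pres_inv pres_mul.
Proof.
move=> x; rewrite -{1}[x]reprK -/(pres_class _).
rewrite /pres_inv pres_mulE; apply/pres_classP; exact: pres_wordV.
Qed.

HB.instance Definition _ := isGroup.Build presented
  pres_mulA pres_mul1g pres_mulg1 pres_mulVg pres_mulgV.

End Presentation.

(* The Baumslag-Solitar group < a, t | t a^m t^-1 = a^l >. The two generators *)
(* are encoded in bool: false is a and true is t.                             *)
Inductive BS_rel (m l : int) : seq (bool * bool) -> seq (bool * bool) -> Prop :=
| BS_relator : BS_rel m l
    ([:: (true, false)] ++ wordz false m ++ [:: (true, true)])
    (wordz false l).

Definition BS (m l : int) : groupType := presented (BS_rel m l).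

Definition BS_a (m l : int) : BS m l := pres_gen (BS_rel m l) false.
Definition BS_t (m l : int) : BS m l := pres_gen (BS_rel m l) true.

Local Open Scope group_scope.

Definition expgz (G : groupType) (g : G) (n : int) : G :=
  match n with Posz k => g ^+ k | Negz k => g ^- k.+1 end.

Definition comm_prod (G : groupType) (n : nat) (g : G) : Prop :=
  exists s : seq (G * G), size s = n /\ g = \prod_(p <- s) [~ p.1, p.2].

(* The inverse of a commutator is a commutator, so products of commutators    *)
(* already form the subgroup [G, G].                                          *)
Definition in_derived (G : groupType) (g : G) : Prop :=
  exists n, comm_prod n g.

(* The value 0 outside [G, G] is junk. *)
Definition cl (G : groupType) (g : G) : nat :=
  match pselect (exists n, `[< comm_prod n g >]) with
  | left h => ex_minn h
  | right _ => 0
  end.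

(* On [G, G] the sequence n |-> cl (g ^+ n) is subadditive, so that the limit *)
(* exists by Fekete's lemma.                                                  *)
Definition scl_derived (R : realType) (G : groupType) (g : G) : R :=
  limn (fun n : nat => (cl (g ^+ n))%:R / n%:R : R)%R.

(* scl_derived (g ^+ k) / k is the same for all k > 0 with g ^+ k in [G, G];  *)
(* the least such k is used, which is 1 when g is in [G, G].                  *)
Definition scl (R : realType) (G : groupType) (g : G) : \bar R :=
  match pselect (exists k, (0 < k)%N && `[< in_derived (g ^+ k) >]) with
  | left h => (scl_derived R (g ^+ ex_minn h) / (ex_minn h)%:R)%R%:E
  | right _ => +oo%E
  end.

(* Main.v *)
Require Import Defs.
From HB Require Import structures.
From mathcomp Require Import all_boot all_order all_algebra.
From mathcomp Require Import all_classical all_reals all_analysis.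
From mathcomp Require Import zify ring lra.

(** Write x = t a^i t^-1, y = a^j and g = x y, and let p = |m| / gcd(i, m) and
    q = |l| / gcd(j, l). The powers x^p and y^q are powers of a^l, which
    commutes with both x and y; so, up to a central cyclic group, x and y
    generate a quotient of the free product of Z/p and Z/q, and g bounds a disc
    with two cone points of orders p and q. The claimed value
    (1 - 1/p - 1/q) / 2 is minus half the orbifold Euler characteristic of that
    disc.

    Upper bound. The word x^N y^N with N = p q grows from the empty word by
    inserting one copy of g at a time in the middle, and each inserted g can
    be moved to the end as a conjugate of g. When p divides the current
    exponent of x, or q that of y, this power is central and the inserted g
    can instead be absorbed into one of two large powers of g
    ([planar_prefix]); if p and q are not coprime, one starts from y rather
    than from the empty word, so that the two cases never coincide. The result
    is a relation between the central element x^N y^N and a product of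
    conjugates of powers of g, of total exponent N, with N - N/p - N/q + 2
    factors: a planar surface. Taking n-th powers factor by factor costs n/2
    commutators for every factor beyond the second ([near_exp_planar]), which
    gives g^(N n) as a central element times about n (N - N/p - N/q) / 2
    commutators ([near_exp_mul_central]). The central element is a power of a,
    and it is a single commutator as soon as l - m divides its exponent,
    because t a^(m r) t^-1 a^(- m r) = a^((l - m) r) ([BS_comm_exp]).

    Lower bound. In the Bass-Serre tree, the geodesic from the base vertex to
    its translate by a group element turns at each interior vertex. When the
    two edges of a turn lie in the same orbit type, the turn is measured by an
    integer modulo m or modulo l, to which a sawtooth function is applied; all
    other turns weigh 0. The sum of these weights is a function on the group.
    Comparing the geodesics of g, h and g h amounts to looking at the centre of
    one tripod, and the sawtooth has defect at most 1, so this function is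
    additive up to 1 ([turning_run_defect]). After being made odd it is at most
    4 c on a product of c commutators ([comm_prod_quasimorphism]). On the n-th
    power of g it is about n ((1 - 2/p) + (1 - 2/q)) for sawtooth slopes chosen
    by the Bezout identity ([sawtooth_bezout]), whence c >= n (1 - 1/p - 1/q) / 2
    up to a constant. *)

Set Implicit Arguments.
Unset Strict Implicit.
Unset Printing Implicit Defensive.

Import Order.TTheory GRing.Theory Num.Theory.
Import numFieldNormedType.Exports.

(** * Equality up to commutators *)

Section Commutators.
Variable G : groupType.
Implicit Types (u v w x y g h : G) (n k : nat).
Local Open Scope group_scope.

Lemma comm_prod0 : comm_prod 0 (1 : G).
Proof. by exists [::]; rewrite big_nil. Qed.

Lemma comm_prodR u v : comm_prod 1 [~ u, v].
Proof. by exists [:: (u, v)]; rewrite big_seq1. Qed.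

Lemma comm_prodM n k u v :
  comm_prod n u -> comm_prod k v -> comm_prod (n + k) (u * v).
Proof.
move=> [s [sn ->]] [s' [sk ->]]; exists (s ++ s').
by rewrite size_cat sn sk big_cat.
Qed.

Lemma comm_prodV n u : comm_prod n u -> comm_prod n u^-1.
Proof.
elim: n u => [|n IHn] u [[|p s] [//= + ->]].
  by move=> _; rewrite big_nil invg1; exact: comm_prod0.
move=> [ss]; rewrite big_cons invgM invgR -addn1; apply: comm_prodM.
  by apply: IHn; exists s.
exact: comm_prodR.
Qed.

Lemma comm_prodJ n u w : comm_prod n u -> comm_prod n (u ^ w).
Proof.
move=> [s [sn ->]]; exists [seq (p.1 ^ w, p.2 ^ w) | p <- s].
rewrite size_map big_map conjg_prod; split=> //.
by apply: eq_bigr => p _; rewrite conjRg.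
Qed.

(** Equality up to n commutators: since commutators are closed under
    conjugation, the side on which the error is placed does not matter. *)
Definition near_mod n u v := comm_prod n (u^-1 * v).

Lemma near_refl u : near_mod 0 u u.
Proof. by rewrite /near_mod mulVg; exact: comm_prod0. Qed.

Lemma near_sym n u v : near_mod n u v -> near_mod n v u.
Proof. by move/comm_prodV; rewrite invgM invgK. Qed.

Lemma near_trans n k u v w :
  near_mod n u v -> near_mod k v w -> near_mod (n + k) u w.
Proof. by move=> uv vw; have := comm_prodM uv vw; rewrite mulgA mulgK. Qed.

Lemma near_mull n w u v : near_mod n u v -> near_mod n (w * u) (w * v).
Proof. by rewrite /near_mod invgM -mulgA mulKg. Qed.

Lemma near_mulr n w u v : near_mod n u v -> near_mod n (u * w) (v * w).
Proof. by move/(comm_prodJ w); rewrite /near_mod conjgE invgM !mulgA. Qed.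

Lemma near_mul n k u u' v v' :
  near_mod n u u' -> near_mod k v v' -> near_mod (n + k) (u * v) (u' * v').
Proof. by move=> /(near_mulr v) un /(near_mull u') vn; exact: near_trans un vn. Qed.

Lemma near_conj u w : near_mod 1 u (u ^ w).
Proof. exact: comm_prodR. Qed.

(** The hexagon with sides u, v, w, u^-1, v^-1, w^-1 glues up to a torus. *)
Lemma near_rev3 u v w : near_mod 1 (u * v * w) (w * v * u).
Proof.
suff -> : near_mod 1 (u * v * w) (w * v * u) =
  comm_prod 1 [~ v * w, w^-1 * u] by exact: comm_prodR.
by rewrite /near_mod commgEl conjgE !gnorm.
Qed.

(** One commutator merges three consecutive copies of u v into u^3 v^3, that
    is, it removes two of the n alternations; hence n / 2 commutators. *)
Lemma near_expM n u v : near_mod n./2 ((u * v) ^+ n) (u ^+ n * v ^+ n).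
Proof.
elim/ltn_ind: n => -[|[|n]] IHn; rewrite ?expg0 ?mulg1 ?expg1;
  try exact: near_refl.
have -> : (u * v) ^+ n.+2 = u * v * (u * v * (u * v) ^+ n) by rewrite !expgS.
rewrite /= -addn1.
apply: near_trans (near_mull (u * v) (near_mull (u * v) (IHn n _))) _ => //.
have := near_mull u (near_mulr (v ^+ n) (near_rev3 v (u * v) (u ^+ n))).
have -> : u ^+ n.+2 * v ^+ n.+2 = u * (u ^+ n * (u * v) * v * v ^+ n).
  by rewrite (expgS u) (expgSr u) 2!(expgS v) !mulgA.
by rewrite !mulgA.
Qed.

Lemma near_exp_prod n b (bs : seq G) :
  near_mod (size bs * n./2) ((b * \prod_(c <- bs) c) ^+ n)
    (b ^+ n * \prod_(c <- bs) c ^+ n).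
Proof.
elim: bs b => [|c bs IHbs] b.
  by rewrite !big_nil !mulg1; exact: near_refl.
rewrite !big_cons /= mulSn.
by apply: near_trans (near_expM n _ _) (near_mull _ (IHbs c)).
Qed.

Lemma near_conj_prod n h (bs : seq (nat * G)) :
  near_mod (size bs) (\prod_(b <- bs) ((h ^+ b.1) ^ b.2) ^+ n)
    (h ^+ (sumn (unzip1 bs) * n)).
Proof.
elim: bs => [|[k u] bs IHbs] /=.
  by rewrite big_nil; exact: near_refl.
rewrite big_cons mulnDl expgnDr -add1n; apply: near_mul IHbs.
rewrite -conjXg -expgnA; exact/near_sym/near_conj.
Qed.

(** A sphere whose boundary circles are powers of g. One of the factors is
    carried to the other side before taking n-th powers, so that the cost is
    n / 2 for each of the remaining factors but one. The additive constant pays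
    for undoing the conjugations. *)
Lemma near_exp_planar n g z k b (bs : seq (nat * G)) :
  commute z g ->
  z = g ^+ k * \prod_(c <- b :: bs) (g ^+ c.1) ^ c.2 ->
  near_mod (size bs * n./2 + (size bs).+1)
    (g ^+ ((k + sumn (unzip1 (b :: bs))) * n)) (z ^+ n).
Proof.
move=> zg zE; apply: near_sym; rewrite mulnDl expgnDr.
have -> : z ^+ n = g ^+ (k * n) * (g ^- k * z) ^+ n.
  have gz : commute (g ^- k) z.
    by apply/commute_sym/commuteV/commuteX.
  by rewrite expgMn // expVgn -expgnA mulgA mulgV mul1g.
apply: near_mull; rewrite {1}zE mulKg.
have /(_ n) := near_exp_prod _ ((g ^+ b.1) ^ b.2) [seq (g ^+ c.1) ^ c.2 | c <- bs].
rewrite size_map !big_map => bn; rewrite big_cons; apply: near_trans bn _.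
by have := near_conj_prod n g (b :: bs); rewrite big_cons.
Qed.

(** * A planar relation among conjugates of powers of x y *)

Section Planar.
Variables (x y g : G) (p q e : nat).
Hypotheses (xpy : commute (x ^+ p) y) (yqx : commute (y ^+ q) x).
Hypothesis gE : g = x * y.

(** Steps at which neither x^s nor y^(s + e) is central. The offset e serves to
    keep the two kinds of central steps apart when p and q are not coprime. *)
Definition inner_face s := ~~ (p %| s) && ~~ (q %| s + e).

(** Passing from s to s + 1 inserts g between x^s and y^(s + e). If x^s is
    central, then g comes out on the left; if y^(s + e) is central, it comes out
    on the right; otherwise it is conjugated by y^(s + e). *)
Lemma planar_prefix s : exists k1 k2 (hs : seq G),
  [/\ k1 + k2 + size hs = s, size hs = \sum_(0 <= r < s) inner_face r
    & x ^+ s * y ^+ (s + e) =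
      g ^+ k1 * y ^+ e * g ^+ k2 * \prod_(h <- hs) g ^ h].
Proof.
elim: s => [|s [k1 [k2 [hs [sE hsE IHs]]]]].
  by exists 0, 0, [::]; split; rewrite ?big_geq ?big_nil ?mul1g ?mulg1.
have wE : x ^+ s.+1 * y ^+ (s.+1 + e) = x ^+ s * g * y ^+ (s + e).
  by rewrite gE expgSr addSn expgS !mulgA.
rewrite big_nat_recr //= -hsE wE /inner_face.
case: (boolP (p %| s)) => [/dvdnP[r sr]|_] /=.
  exists k1.+1, k2, hs; split; rewrite ?addn0 ?addSn ?sE //.
  have xg : commute (x ^+ s) g.
    rewrite gE; apply: commuteM; first exact/commute_sym/commuteX.
    by rewrite sr mulnC expgnA; apply/commute_sym/commuteX/commute_sym.
  by rewrite xg -mulgA IHs expgS !mulgA.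
case: (boolP (q %| s + e)) => [/dvdnP[r sr]|_] /=.
  exists k1, k2.+1, [seq h * g | h <- hs].
  split; rewrite ?size_map ?addn0 ?addnS ?addSn ?sE //.
  have yg : commute g (y ^+ (s + e)).
    rewrite gE; apply/commute_sym/commuteM; last exact/commute_sym/commuteX.
    by rewrite sr mulnC expgnA; apply/commute_sym/commuteX/commute_sym.
  rewrite -mulgA yg mulgA IHs big_map expgSr.
  under eq_bigr => h _ do rewrite conjgM.
  by rewrite -conjg_prod -!mulgA -conjgC.
exists k1, k2, (rcons hs (y ^+ (s + e))).
rewrite size_rcons addnS sE addn1; split=> //.
by rewrite -cats1 big_cat big_seq1 /= mulgA -IHs -!mulgA -conjgC.
Qed.
End Planar.
End Commutators.

Lemma sum_periodic_shift (N e : nat) (f : nat -> nat) :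
  (forall s, f (s + N) = f s) ->
  \sum_(0 <= s < N) f (s + e) = \sum_(0 <= s < N) f s.
Proof.
move=> fN; elim: e => [|e <-]; first by under eq_bigr do rewrite addn0.
case: N fN => [|N] fN; first by rewrite !big_geq.
rewrite big_nat_recr // [RHS]big_nat_recl //= addnC.
rewrite (_ : N + e.+1 = e + N.+1); last by rewrite addnS addnC addnS.
by rewrite fN add0n; congr addn; apply: eq_bigr => s _; rewrite addnS.
Qed.

Lemma sum_dvdn_shift (p q e : nat) :
  0 < p -> \sum_(0 <= s < p * q) (p %| s + e) = q.
Proof.
move=> p_gt0; rewrite (@sum_periodic_shift _ _ (fun s => p %| s : nat)); last first.
  by move=> s; rewrite dvdn_addl // dvdn_mulr.
elim: q => [|q IHq]; first by rewrite muln0 big_geq.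
rewrite mulnS addnC (@big_cat_nat _ _ _ (p * q)) ?leq_addr //= IHq -{1}[p * q]add0n.
rewrite [p * q + p]addnC big_addn addnK -[p]prednK // big_nat_recl // prednK //.
rewrite add0n dvdn_mulr // big_nat big1 ?addn0 ?addn1 // => s sp.
by rewrite dvdn_addl ?dvdn_mulr // gtnNdvd //; case/andP: sp; lia.
Qed.

(** With offset 1, a common factor of p and q excludes coincidences between
    multiples of p and of q; with offset 0 and p, q coprime there is exactly one
    coincidence in a period, at s = 0. *)
Lemma sum_inner_face (p q : nat) : 0 < p -> 0 < q ->
  \sum_(0 <= s < p * q) inner_face p q (~~ coprime p q) s + p + q =
    p * q + coprime p q.
Proof.
move=> p_gt0 q_gt0; set e : nat := ~~ _.
have dvdp := sum_dvdn_shift q 0 p_gt0; have dvdq := sum_dvdn_shift p e q_gt0.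
rewrite mulnC in dvdq.
have both : \sum_(0 <= s < p * q) ((p %| s) && (q %| s + e)) = coprime p q.
  rewrite /e; case: (boolP (coprime p q)) => [pq | pq] /=; last first.
    (* the gcd of p and q would divide both s and s + 1 *)
    apply: big1 => s _; apply/eqP; rewrite eqb0; apply: contra pq => /andP[ps qs].
    rewrite /coprime -dvdn1 -(dvdn_addr 1 (dvdn_trans (dvdn_gcdl p q) ps)).
    exact: dvdn_trans (dvdn_gcdr p q) qs.
  have pq_gt0 : 0 < p * q by rewrite muln_gt0 p_gt0.
  rewrite -[p * q]prednK // big_nat_recl // addn0 !dvdn0.
  rewrite big_nat big1 ?addn0 // => s /andP[_ sp]; apply/eqP; rewrite eqb0 addn0.
  by rewrite -Gauss_dvd // gtnNdvd //; lia.
have total : \sum_(0 <= s < p * q) (inner_face p q e s + (p %| s + 0) + (q %| s + e))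
    = \sum_(0 <= s < p * q) (1 + ((p %| s) && (q %| s + e))).
  by apply: eq_bigr => s _; rewrite /inner_face addn0; do 2 case: (_ %| _).
by move: total; rewrite !big_split /= dvdp dvdq both sum_nat_const_nat; lia.
Qed.

Section PlanarPower.
Variables (G : groupType) (x y : G) (p q : nat).
Hypotheses (xpy : commute (x ^+ p)%g y) (yqx : commute (y ^+ q)%g x).
Hypotheses (p_gt1 : 1 < p) (q_gt1 : 1 < q).
Local Open Scope group_scope.

(** In the coprime case the two large powers of g coming from [planar_prefix]
    are adjacent and form one factor, which makes up for the additional inner
    face; so both cases have the same number of factors. *)
Lemma near_exp_mul_central n (K := (p * q - p - q)%N) :
  near_mod (K * n./2 + K.+1) ((x * y) ^+ (p * q * n))
    ((x ^+ (p * q) * y ^+ (p * q)) ^+ n).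
Proof.
set g := x * y; set z := _ * _; have gE : g = x * y by [].
have zg : commute z g.
  apply/commute_sym/commuteM; apply/commute_sym; rewrite gE; apply/commuteM.
  - exact/commute_sym/commuteX.
  - by rewrite expgnA; apply/commute_sym/commuteX/commute_sym.
  - by rewrite mulnC expgnA; apply/commute_sym/commuteX/commute_sym.
  - exact/commute_sym/commuteX.
have [k1 [k2 [hs [NE hsE]]]] :=
  planar_prefix (~~ coprime p q) xpy yqx gE (p * q).
have := sum_inner_face (ltnW p_gt1) (ltnW q_gt1); rewrite -hsE.
have pq_ge : (p + q <= p * q)%N by nia.
have sumE (f : G -> G) us : sumn (unzip1 [seq (1%N, f u) | u <- us]) = size us.
  by elim: us => //= u us ->.
case: (boolP (coprime p q)) => _ /= hsK.
- rewrite addn0 mulg1 -expgnDr -/z => zE.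
  case: hs hsK NE hsE zE => [|h hs] /= hsK NE hsE zE; first by lia.
  have := @near_exp_planar _ n g z (k1 + k2) (1%N, h) [seq (1%N, u) | u <- hs] zg.
  rewrite zE !big_cons big_map size_map => /(_ erefl).
  have -> : size hs = K by lia.
  rewrite /= (sumE id); have -> // : (k1 + k2 + (1 + size hs) = p * q)%N by lia.
- rewrite addn1 expgSr mulgA -/z => zE.
  have := @near_exp_planar _ n g z k1 (k2, y^-1) [seq (1%N, u * y^-1) | u <- hs] zg.
  rewrite big_cons big_map size_map /=.
  under eq_bigr => u _ do rewrite expg1 conjgM.
  rewrite -conjg_prod -conjMg sumE.
  have -> : (k1 + (k2 + size hs) = p * q)%N by lia.
  have -> : size hs = K by lia.
  apply; apply: (@mulIg _ y); rewrite zE conjgE invgK expg1 -!mulgA.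
  by rewrite mulVg mulg1.
Qed.
End PlanarPower.

(** * The sawtooth function *)

Section Sawtooth.
Variables (R : realFieldType) (M : int).
Hypothesis M_neq0 : M != 0%R.
Implicit Types (k r : int).
Local Open Scope ring_scope.

Definition sawtooth k : R :=
  let r := (k %% M)%Z in if r == 0 then 0 else 1 - 2 * (r%:~R / `|M|%:~R).

Lemma sawtooth_mod k k' : (k = k' %[mod M])%Z -> sawtooth k = sawtooth k'.
Proof. by rewrite /sawtooth => ->. Qed.

Lemma modz_uniq k r : 0 <= r < `|M| -> (M %| k - r)%Z -> (k %% M)%Z = r.
Proof.
move=> r_bound; rewrite -eqz_mod_dvd => /eqP ->.
by rewrite -modz_abs modz_small.
Qed.

Lemma modz_range k :
  exists2 r, (k %% M)%Z = r & 0 <= r < `|M| /\ (M %| k - r)%Z.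
Proof.
exists (k %% M)%Z => //; rewrite modz_ge0 // ltz_mod //; split=> //.
by rewrite -eqz_mod_dvd modz_mod.
Qed.

Lemma residue_ratio r : 0 <= r < `|M| -> r != 0 ->
  0 < (r%:~R / `|M|%:~R : R) < 1.
Proof.
move=> /andP[r0 rM] r_neq0; have M0 : 0 < `|M|%:~R :> R by rewrite ltr0z normr_gt0.
by rewrite ltr_pdivrMr // mul1r ltr_int rM divr_gt0 // ltr0z lt0r r_neq0.
Qed.

Lemma sawtooth_norm k : `|sawtooth k| <= 1.
Proof.
rewrite /sawtooth; have [r -> [r_bound _]] := modz_range k.
case: (eqVneq r 0) => [_|r0]; first by rewrite normr0.
by have := residue_ratio r_bound r0; rewrite ler_norml; lra.
Qed.

Lemma modz_add k k' r r' :
  (k %% M)%Z = r -> (k' %% M)%Z = r' ->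
  ((k + k') %% M)%Z = if r + r' < `|M| then r + r' else r + r' - `|M|.
Proof.
have [s -> [sb sk]] := modz_range k; have [s' -> [sb' sk']] := modz_range k'.
move=> <- <-.
apply: modz_uniq; first by case: ifP; lia.
have sum_dvd : (M %| (k + k') - (s + s'))%Z.
  have -> : k + k' - (s + s') = (k - s) + (k' - s') by ring.
  by rewrite rpredD.
case: ifP => // _; rewrite opprB addrA addrAC.
by rewrite rpredD // dvdzE abszE.
Qed.

(** The sum of two residues is the residue of the sum, or exceeds it by |M|;
    the affine parts cancel and leave 1, 0 or -1. *)
Lemma sawtooth_defect k k' :
  `|sawtooth k + sawtooth k' - sawtooth (k + k')| <= 1.
Proof.
rewrite /sawtooth; have [r rE [rb _]] := modz_range k.
have [r' rE' [rb' _]] := modz_range k'; rewrite (modz_add rE rE') rE rE'.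
have := @residue_ratio r rb; have := @residue_ratio r' rb'.
have M0 : `|M|%:~R != 0 :> R by rewrite intr_eq0 normr_eq0.
rewrite /= => hr' hr; case: (ltP (r + r') `|M|) => sumM.
- rewrite intrD (mulrDl r%:~R).
  case: (eqVneq r 0) hr => [r0 _|r0 /(_ isT) hr].
    rewrite r0 !add0r; case: (eqVneq r' 0) => [_|_].
      by rewrite subr0 normr0.
    by rewrite mulr0z mul0r add0r subrr normr0.
  have rr0 : r + r' != 0 by lia.
  rewrite (negPf rr0); case: (eqVneq r' 0) hr' => [-> _|_ /(_ isT) hr'].
    by rewrite mulr0z mul0r !addr0 subrr normr0.
  by rewrite ler_norml; lra.
- have r0 : r != 0 by lia.
  have r0' : r' != 0 by lia.
  move: (hr r0) (hr' r0') => {}hr {}hr'; rewrite (negPf r0) (negPf r0').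
  rewrite intrB intrD mulrBl (mulrDl r%:~R) divff //; case: (eqVneq _ 0) => [/eqP|_].
    move/eqP/(congr1 (fun z : int => z%:~R / `|M|%:~R : R)).
    rewrite intrB intrD mulrBl (mulrDl r%:~R) divff // mul0r => sum1.
    by rewrite ler_norml; lra.
  by rewrite ler_norml; lra.
Qed.

Lemma sawtooth_opp k k' : (M %| k + k')%Z -> sawtooth k + sawtooth k' = 0.
Proof.
move/dvdz_mod0P; have [r rE [rb _]] := modz_range k.
have [r' rE' [rb' _]] := modz_range k'; rewrite (modz_add rE rE') => sum0.
rewrite /sawtooth rE rE'; case: (eqVneq r 0) => [r0|r0].
  have -> : r' = 0 by move: sum0; case: ifP; lia.
  by rewrite eqxx addr0.
have r0' : r' != 0 by move: sum0; case: ifP; lia.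
have M0 : `|M|%:~R != 0 :> R by rewrite intr_eq0 normr_eq0.
have -> : r' = `|M| - r by move: sum0; case: ifP; lia.
have -> : `|M| - r == 0 = false by lia.
by rewrite intrB mulrBl divff //; lra.
Qed.
End Sawtooth.

(** * Turns along paths in the Bass-Serre tree *)

Section StackMachine.
Variables (R : realFieldType) (m l cm cl : int).
Hypotheses (m_neq0 : m != 0%R) (l_neq0 : l != 0%R).
Local Open Scope ring_scope.

(** The letter t^e, with e = true for the inverse, satisfies
    a^(modulus e) t^e = t^e a^(modulus (~~ e)). *)
Definition modulus (e : bool) : int := if e then m else l.
Definition weight (e : bool) : int := if e then cm else cl.

Lemma modulus_neq0 e : modulus e != 0. Proof. by case: e. Qed.

(** The weight of the turn t^e a^k t^e' of a path in the Bass-Serre tree. The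
    missing letter at an end of a path is [None]. *)
Definition turn (o : option bool) (k : int) (o' : option bool) : R :=
  match o, o' with
  | Some e, Some e' =>
    if e' == ~~ e then sawtooth R (modulus e') (weight e' * k) else 0
  | _, _ => 0
  end.

Definition backtrack (o : option bool) (k : int) (e : bool) :=
  (o == Some (~~ e)) && (modulus e %| k)%Z.

Lemma turn_mod o k k' e :
  (modulus e %| k - k')%Z -> turn o k (Some e) = turn o k' (Some e).
Proof.
case: o => //= e' kk'; case: ifP => // _; apply: sawtooth_mod; apply/eqP.
by rewrite eqz_mod_dvd -mulrBr dvdz_mull.
Qed.

(** A power of a that crosses t^e leaves the weight of the next turn unchanged. *)
Lemma turn_shift e k q o :
  turn (Some e) (modulus (~~ e) * q + k) o = turn (Some e) k o.
Proof.
case: o => //= e'; case: eqP => // ->; apply: sawtooth_mod; apply/eqP.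
by rewrite eqz_mod_dvd -mulrBr addrK dvdz_mull // dvdz_mulr.
Qed.

Lemma backtrack_shift e k q e' :
  backtrack (Some e) (modulus (~~ e) * q + k) e' = backtrack (Some e) k e'.
Proof.
rewrite /backtrack; case: eqP => //= -[->]; rewrite negbK.
by rewrite rpredDl ?dvdz_mulr.
Qed.

Lemma turn_norm o k o' : `|turn o k o'| <= 1.
Proof.
case: o o' => [e|] [e'|] /=; rewrite ?normr0 //.
by case: ifP => _; rewrite ?normr0 // sawtooth_norm ?modulus_neq0.
Qed.

(** The three turns at the centre of a tripod. Either all three connect edges
    of the same type, and the bound is the defect of the sawtooth, or at most
    one of them has a nonzero weight. *)
Lemma turn_tripod o o' e r k q :
  `|turn o (r + modulus (~~ e) * q + k) o' - turn o r (Some (~~ e))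
    - turn (Some e) k o'| <= 1.
Proof.
have norm1 := turn_norm; case: o => [a|]; last first.
  by have := norm1 (Some e) k o'; rewrite /= subrr sub0r normrN.
case: o' => [b|]; last first.
  by have := norm1 (Some a) r (Some (~~ e)); rewrite /= sub0r subr0 normrN.
have [-> | ae] := eqVneq a e.
  have [-> | be] := eqVneq b (~~ e); last first.
    have -> : turn (Some e) (r + modulus (~~ e) * q + k) (Some b) = 0.
      by rewrite /= (negPf be).
    have -> : turn (Some e) k (Some b) = 0 by rewrite /= (negPf be).
    by rewrite subr0 sub0r normrN norm1.
  rewrite -[r + _ + k]addrA addrCA turn_shift /= eqxx mulrDr -normrN !opprB addrA.
  rewrite [X in `|X - _|]addrC; apply: sawtooth_defect; exact: modulus_neq0.
have -> : turn (Some a) r (Some (~~ e)) = 0.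
  by move: ae; case: a; case: e.
rewrite subr0; have [-> | be] := eqVneq b (~~ e); last first.
  have -> : turn (Some e) k (Some b) = 0 by rewrite /= (negPf be).
  by rewrite subr0 norm1.
have -> : turn (Some a) (r + modulus (~~ e) * q + k) (Some (~~ e)) = 0.
  by move: ae; case: a; case: e.
by rewrite sub0r normrN norm1.
Qed.

Arguments turn : simpl never.

(** Stacks list the letters a^r t^e of a path from the last to the first,
    because multiplication on the right acts on the last letter. *)
Definition top (s : seq (int * bool)) := omap snd (ohead s).

Fixpoint turning (s : seq (int * bool)) : R :=
  if s is (r, e) :: s' then turn (top s') r (Some e) + turning s' else 0.

(** The same sum for a path that lists its letters from the first to the last. *)
Fixpoint turning_path (L : seq (int * bool)) : R :=
  if L is (k, e) :: L' then
    (if L' is (k', e') :: _ then turn (Some e) k' (Some e') else 0)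
    + turning_path L'
  else 0.

Definition no_backtrack (c c' : int * bool) := ~~ backtrack (Some c.2) c'.1 c'.2.

(** The state ([:: (r_n, e_n); ...; (r_1, e_1)], k) stands for the group element
    a^(r_1) t^(e_1) ... a^(r_n) t^(e_n) a^k. *)
Notation state := (seq (int * bool) * int)%type.

Definition step_a (k : int) (S : state) : state := (S.1, S.2 + k).

(** Multiplication on the right by t^e either cancels the last letter or adds
    a letter; in both cases a multiple of the modulus crosses t^e. *)
Definition step_t (e : bool) (S : state) : state :=
  let q := (S.2 %/ modulus e)%Z in
  if backtrack (top S.1) S.2 e
  then (behead S.1, (head (0, e) S.1).1 + modulus (~~ e) * q)
  else ((S.2 %% modulus e, e)%Z :: S.1, modulus (~~ e) * q).

Definition step_at (S : state) (c : int * bool) := step_t c.2 (step_a c.1 S).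
Definition run (S : state) L := foldl step_at S L.

(** Without cancellation at the junction, the turns of the product are those
    of the two factors and the turn at the junction. *)
Lemma turning_run_reduced s k k1 e1 L :
  sorted no_backtrack ((k1, e1) :: L) -> ~~ backtrack (top s) (k + k1) e1 ->
  turning (run (s, k) ((k1, e1) :: L)).1 =
    turning s + turn (top s) (k + k1) (Some e1) + turning_path ((k1, e1) :: L).
Proof.
elim: L s k k1 e1 => [|[k2 e2] L IHL] s k k1 e1 redL nb.
  rewrite /= /step_at /step_t /= (negPf nb) /=.
  rewrite (@turn_mod _ _ (k + k1)); last by rewrite -eqz_mod_dvd modz_mod.
  by ring.
move: redL => /= /andP[nb2 redL].
rewrite -[run _ _]/(run (step_at (s, k) (k1, e1)) ((k2, e2) :: L)).
rewrite /step_at /step_t /= (negPf nb) IHL //=; last by rewrite backtrack_shift.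
rewrite turn_shift (@turn_mod _ _ (k + k1)); last by rewrite -eqz_mod_dvd modz_mod.
by ring.
Qed.

Lemma turning_run_nil k L : sorted no_backtrack L ->
  turning (run ([::], k) L).1 = turning_path L.
Proof.
case: L => [|[k1 e1] L] // redL.
by rewrite turning_run_reduced //= !add0r.
Qed.

(** The letters that cancel belong to a segment travelled back and forth, on
    which the weights cancel in pairs; what remains is the turn at the junction,
    or the tripod at the end of that segment. *)
Lemma turning_run_defect s k L : sorted no_backtrack L ->
  `|turning (run (s, k) L).1 - turning s - turning_path L| <= 1.
Proof.
elim: L s k => [|[k1 e1] L IHL] s k redL.
  by rewrite /= !subr0 subrr normr0.
have [bt|nb] := boolP (backtrack (top s) (k + k1) e1); last first.
  rewrite turning_run_reduced // (_ : _ - _ = turn (top s) (k + k1) (Some e1)).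
    exact: turn_norm.
  by ring.
rewrite -[run _ _]/(run (step_at (s, k) (k1, e1)) L).
rewrite /step_at /step_t bt /=.
case: s bt => [|[r e] s] /andP[/eqP[]] //= -> _.
set q := (_ %/ _)%Z.
case: L IHL redL => [|[k2 e2] L] IHL redL.
  have := turn_tripod (top s) None e1 r 0 q.
  rewrite /= subr0; congr (`|_| <= 1); rewrite {1}/turn.
  by case: (top s) => [?|]; ring.
move: redL => /= /andP[nb2 redL].
(* If the cancellation goes on, both weights are at the same vertex and
   opposite; if it stops, this vertex is the centre of the tripod. *)
have [bt|nb] := boolP (backtrack (top s) (r + modulus (~~ e1) * q + k2) e2).
  have := IHL s (r + modulus (~~ e1) * q) redL.
  congr (`|_| <= 1).
  suff: turn (top s) r (Some (~~ e1)) + turn (Some e1) k2 (Some e2) = 0.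
    by move=> /= z0; lra.
  case/andP: bt => /eqP ->; rewrite /turn.
  have -> : (~~ e1 == ~~ ~~ e2) = (e2 == ~~ e1) by case: (e1) (e2) => [] [].
  case: eqP => [->|_] dv; last by rewrite addr0.
  apply: sawtooth_opp; first exact: modulus_neq0.
  rewrite -mulrDr dvdz_mull //.
  by move: dv; rewrite addrAC [X in (_ %| X)%Z]addrC; rewrite rpredDl ?dvdz_mulr.
rewrite turning_run_reduced //=.
have := turn_tripod (top s) (Some e2) e1 r k2 q.
by congr (`|_| <= 1); rewrite /=; ring.
Qed.
End StackMachine.

(** * Integer powers and presentations *)

Section IntegerPowers.
Variable G : groupType.
Implicit Types (g h : G) (n k : int).
Local Open Scope group_scope.

Lemma expgzN g n : expgz g (- n)%R = (expgz g n)^-1.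
Proof.
by case: n => [[|n]|n]; rewrite ?NegzE ?opprK /= ?invgK ?invg1.
Qed.

Lemma expgzS g n : expgz g (n + 1)%R = expgz g n * g.
Proof.
case: n => [n|[|n]]; first by rewrite -PoszD addn1 /= expgSr.
  by rewrite NegzE addNr /= expg1 mulVg.
have -> : (Negz n.+1 + 1 = Negz n)%R by rewrite !NegzE; lia.
by rewrite /= (expgS g n.+1) invgM mulgVK.
Qed.

Lemma expgzD g n k : expgz g (n + k)%R = expgz g n * expgz g k.
Proof.
elim/int_rec: k => [|k IHk|k IHk]; first by rewrite addr0 mulg1.
  by rewrite -addn1 PoszD addrA expgzS IHk expgzS mulgA.
apply: (@mulIg _ g); rewrite -expgzS -mulgA -expgzS.
have -> : (- k.+1%:Z + 1 = - k%:Z)%R by lia.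
by rewrite -IHk; congr expgz; lia.
Qed.

Lemma expgzJ g h n : expgz (g ^ h) n = expgz g n ^ h.
Proof. by case: n => n /=; rewrite -conjXg ?conjVg. Qed.

Lemma expgzM g n k : expgz g (n * k)%R = expgz (expgz g n) k.
Proof.
elim/int_rec: k => [|k IHk|k IHk]; first by rewrite mulr0.
  by rewrite -addn1 PoszD mulrDr mulr1 expgzS expgzD IHk.
apply: (@mulIg _ (expgz g n)); rewrite -expgzS -expgzD.
have -> : (- k.+1%:Z + 1 = - k%:Z)%R by lia.
by rewrite -IHk; congr expgz; lia.
Qed.

Lemma expgz_exp g n (k : nat) : expgz g n ^+ k = expgz g (n * k%:Z)%R.
Proof. by rewrite expgzM. Qed.

Lemma expgz_conj_mul g h u n : g * u = u * h -> expgz g n * u = u * expgz h n.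
Proof.
by move=> gu; have -> : h = g ^ u; rewrite ?expgzJ -?conjgC // conjgE gu mulKg.
Qed.
End IntegerPowers.

Section Presentations.
Variables (X : choiceType) (rels : seq (X * bool) -> seq (X * bool) -> Prop).
Local Notation gen := (pres_gen rels).
Local Notation class := (pres_class rels).
Local Open Scope group_scope.

Lemma pres_class_cat u v : class (u ++ v) = class u * class v.
Proof. by rewrite -pres_mulE. Qed.

Lemma pres_class_inv_gen x : class [:: (x, true)] = (gen x)^-1.
Proof.
apply/esym/mulg1_eq; rewrite -pres_class_cat; apply/pres_classP.
exact: pres_cancel.
Qed.

Lemma pres_class_wordz x n : class (wordz x n) = expgz (gen x) n.
Proof.
have nseqE b k : class (nseq k (x, b)) = class [:: (x, b)] ^+ k.
  elim: k => [//|k IHk]; rewrite expgS -IHk -pres_class_cat //.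
by case: n => n; rewrite /wordz nseqE // pres_class_inv_gen /= expVgn.
Qed.
End Presentations.

(** * The action of the group on normal forms *)

Section WellFormed.
Variables (m l : int).
Hypotheses (m_neq0 : m != 0%R) (l_neq0 : l != 0%R).
Local Open Scope ring_scope.

Local Notation state := (seq (int * bool) * int)%type.
Local Notation modulus := (modulus m l).
Local Notation backtrack := (backtrack m l).
Local Notation no_backtrack := (no_backtrack m l).
Local Notation step_t := (step_t m l).

(** Normal forms of group elements: no letter can be cancelled, and the
    exponents are reduced residues, which makes the form unique. *)
Definition reduced_stack (s : seq (int * bool)) :=
  all (fun c => c.1 %% modulus c.2 == c.1)%Z s && sorted no_backtrack (rev s).

Lemma reduced_stack_cons c s : reduced_stack (c :: s) =
  [&& (c.1 %% modulus c.2 == c.1)%Z, ~~ backtrack (top s) c.1 c.2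
    & reduced_stack s].
Proof.
rewrite /reduced_stack !rev_sorted /=; case: s => [|c' s] /=.
  by rewrite !andbT.
by rewrite -!andbA; do !bool_congr.
Qed.

(** Only on normal forms is [step_t (~~ e)] inverse to [step_t e]: elsewhere
    cancelling a letter would lose information. *)
Lemma step_t_cancel e (S : state) :
  reduced_stack S.1 -> step_t (~~ e) (step_t e S) = S.
Proof.
have e0 := modulus_neq0 m_neq0 l_neq0.
case: S => s k /= wf; rewrite {2}/step_t /=.
case: ifP => [/andP[] | nb]; last first.
  rewrite /step_t /= /backtrack /= negbK eqxx dvdz_mulr //= mulKz //.
  by rewrite addrC mulrC -divz_eq.
case: s wf => [|[r e'] s] //= redS /eqP[e'E] /divzK kE.
move: redS; rewrite {}e'E reduced_stack_cons /= => /and3P[/eqP rE nb _].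
have r_small : (r %/ modulus (~~ e))%Z = 0.
  by apply: (mulIf (e0 (~~ e))); have := divz_eq r (modulus (~~ e));
    rewrite rE mul0r; lia.
rewrite /step_t /=.
have -> : backtrack (top s) (r + modulus (~~ e) * (k %/ modulus e)%Z) (~~ e) = false.
  move: nb; rewrite /backtrack; case: eqP => //= _ /negPf.
  by rewrite rpredDr // dvdz_mulr.
rewrite [r + _]addrC [modulus (~~ e) * _]mulrC modzMDl divzMDl //.
by rewrite rE r_small addr0 negbK mulrC kE.
Qed.

Lemma reduced_step_t e (S : state) :
  reduced_stack S.1 -> reduced_stack (step_t e S).1.
Proof.
case: S => s k; rewrite /step_t /=; case: ifP => [bt|nb] /=.
  by case: s {bt} => //= c s; rewrite reduced_stack_cons => /and3P[].
move=> redS; rewrite reduced_stack_cons /= modz_mod eqxx redS andbT /=.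
move/negbT: nb; rewrite /backtrack; congr (~~ (_ && _)).
by apply/dvdz_mod0P/dvdz_mod0P; rewrite modz_mod.
Qed.

Lemma step_t_shift e q (S : state) :
  step_t e (step_a (modulus e * q) S) = step_a (modulus (~~ e) * q) (step_t e S).
Proof.
have e0 := modulus_neq0 m_neq0 l_neq0 e.
case: S => s k; rewrite /step_t /step_a /=.
have -> : backtrack (top s) (k + modulus e * q) e = backtrack (top s) k e.
  by rewrite /backtrack rpredDr ?dvdz_mulr.
rewrite [k + _]addrC [modulus e * q]mulrC modzMDl divzMDl // mulrDr.
by case: ifP => _ /=; congr (_, _); ring.
Qed.

Definition step_letter (S : state) (c : bool * bool) : state :=
  if c.1 then step_t c.2 S else step_a (if c.2 then -1 else 1) S.

Definition act (w : seq (bool * bool)) S := foldl step_letter S w.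

Lemma reduced_act w S : reduced_stack S.1 -> reduced_stack (act w S).1.
Proof.
elim: w S => //= -[[] e] w IHw S redS; apply: IHw => //.
exact: reduced_step_t.
Qed.

Lemma act_wordz n S : act (wordz false n) S = step_a n S.
Proof.
have actE b k : forall S, act (nseq k (false, b)) S = step_a ((if b then -1 else 1) * k%:Z) S.
  elim: k => [|k IHk] [s j] /=; first by rewrite /step_a mulr0 addr0.
  rewrite IHk /step_letter /step_a /=; congr (_, _).
  by case: b {IHk}; lia.
rewrite /wordz actE; congr step_a.
by case: n => n /=; lia.
Qed.

(** Words that are equal in the group act equally, so that the normal form of
    a group element is well defined. *)
Lemma act_pres_eq u v S : pres_eq (BS_rel m l) u v ->
  reduced_stack S.1 -> act u S = act v S.
Proof.
move=> uv; elim: uv S => {u v}.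
- (* t^-1 undoes the step t on the state shifted by l. *)
  move=> _ _ [] S redS; rewrite /act !foldl_cat -!/(act _ _) !act_wordz.
  rewrite /= /step_letter /=; have := step_t_shift false 1 S.
  rewrite !mulr1 => <-; exact: (step_t_cancel false).
- move=> [[] e] S redS /=; rewrite /step_letter /=.
    exact: step_t_cancel.
  by case: S {redS} => s k; rewrite /step_a; case: e; congr (_, _) => /=; lia.
- move=> u u' v v' _ IHu _ IHv S redS.
  by rewrite /act !foldl_cat -!/(act _ _) IHu // IHv // reduced_act.
- by [].
- by move=> u v _ IH S redS; rewrite IH.
- by move=> u v w _ IHu _ IHv S redS; rewrite IHu // IHv.
Qed.
End WellFormed.

Section Evaluation.
Variables (m l : int).
Hypotheses (m_neq0 : m != 0%R) (l_neq0 : l != 0%R).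
Local Open Scope group_scope.
Local Notation state := (seq (int * bool) * int)%type.
Local Notation a := (BS_a m l).
Local Notation t := (BS_t m l).
Local Notation modulus := (modulus m l).

Lemma BS_relation : t * expgz a m = expgz a l * t.
Proof.
have : pres_class (BS_rel m l) ([:: (true, false)] ++ wordz false m ++ [:: (true, true)])
    = pres_class (BS_rel m l) (wordz false l).
  by apply/pres_classP/pres_rel.
rewrite !pres_class_cat !pres_class_wordz pres_class_inv_gen => <-.
by rewrite mulgA mulgVK.
Qed.

Definition t_letter (e : bool) : BS m l := if e then t^-1 else t.

Lemma BS_modulus e q : expgz a (modulus e * q)%R * t_letter e =
  t_letter e * expgz a (modulus (~~ e) * q)%R.
Proof.
rewrite !expgzM; apply: expgz_conj_mul; case: e => /=; last by rewrite BS_relation.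
by apply: (@mulgI _ t); rewrite mulgA BS_relation mulgK mulVKg.
Qed.

Definition eval_path (L : seq (int * bool)) : BS m l :=
  \prod_(c <- L) (expgz a c.1 * t_letter c.2).

Definition eval (S : state) := eval_path (rev S.1) * expgz a S.2.

Lemma eval_step_a k S : eval (step_a k S) = eval S * expgz a k.
Proof. by rewrite /eval /= expgzD mulgA. Qed.

Lemma eval_step_t e S : eval (step_t m l e S) = eval S * t_letter e.
Proof.
case: S => s k; rewrite /eval /step_t /=; case: ifP => [|_] /=.
  case: s => [|[r e'] s] /andP[/eqP[]] //= -> /divzK kE.
  move: (k %/ modulus e)%Z kE => q <-; rewrite [(q * _)%R]mulrC.
  rewrite rev_cons /eval_path -cats1 big_cat big_seq1 /=.
  rewrite -!mulgA BS_modulus expgzD; congr (_ * (_ * _)).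
  by case: (e); rewrite /= ?mulKg ?mulVKg.
rewrite rev_cons /eval_path -cats1 big_cat big_seq1 /= -!mulgA -BS_modulus.
congr (_ * _); rewrite mulgA -expgzD; congr (expgz _ _ * _).
by rewrite addrC mulrC -divz_eq.
Qed.

Lemma eval_act w S : eval (act m l w S) = eval S * pres_class (BS_rel m l) w.
Proof.
elim: w S => [|[b e] w IHw] S /=; first by rewrite mulg1.
rewrite IHw -cat1s pres_class_cat mulgA; congr (_ * _).
case: b; rewrite /step_letter /=.
  by rewrite eval_step_t; case: e; rewrite // pres_class_inv_gen.
by rewrite eval_step_a; case: e; rewrite //= pres_class_inv_gen.
Qed.

Definition gact (g : BS m l) (S : state) := act m l (repr g) S.

Lemma gact_class w S : reduced_stack m l S.1 ->
  gact (pres_class (BS_rel m l) w) S = act m l w S.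
Proof. by move=> redS; apply: act_pres_eq => //; exact: pres_reprK. Qed.

Lemma gactM g h S : reduced_stack m l S.1 -> gact (g * h) S = gact h (gact g S).
Proof. by move=> redS; rewrite gact_class // /act foldl_cat. Qed.

Lemma reduced_gact g S : reduced_stack m l S.1 -> reduced_stack m l (gact g S).1.
Proof. exact: reduced_act. Qed.

Lemma gact_a k S : reduced_stack m l S.1 -> gact (expgz a k) S = step_a k S.
Proof. by move=> redS; rewrite -pres_class_wordz gact_class // act_wordz. Qed.

Lemma gact_t e S : reduced_stack m l S.1 -> gact (t_letter e) S = step_t m l e S.
Proof.
move=> redS; rewrite /t_letter; case: e; last exact: gact_class.
by rewrite -pres_class_inv_gen gact_class.
Qed.

Lemma gact_eval_path L S : reduced_stack m l S.1 ->
  gact (eval_path L) S = run m l S L.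
Proof.
elim: L S => [|[k e] L IHL] S redS; rewrite /eval_path.
  by rewrite big_nil gact_class.
rewrite big_cons /= !gactM ?reduced_gact // gact_a // gact_t //.
by rewrite -/(eval_path L) IHL //; exact: reduced_step_t.
Qed.

Lemma eval_path_reduced g : exists L k,
  sorted (no_backtrack m l) L /\ g = eval_path L * expgz a k.
Proof.
have := eval_act (repr g) ([::], 0%R); rewrite /pres_class reprK => gE.
have := reduced_gact g (S := ([::], 0%R)) isT => /andP[_ redL].
exists (rev (gact g ([::], 0%R)).1), (gact g ([::], 0%R)).2; split=> //.
rewrite -[RHS]/(eval (gact g ([::], 0%R))) [RHS]gE /eval /= /eval_path big_nil.
by rewrite !mul1g.
Qed.
End Evaluation.

(** * Quasimorphisms and stable commutator length *)

Section Quasimorphism.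
Variables (R : realFieldType) (G : groupType) (f : G -> R).
Hypothesis fV : forall g, (f (g^-1)%g = - f g)%R.
Hypothesis f_defect : forall g h, (`|f (g * h)%g - f g - f h| <= 1)%R.
Local Open Scope ring_scope.

(** A product of n commutators has 4 n letters, whose values cancel since f is
    odd; each multiplication costs at most 1. *)
Lemma comm_prod_quasimorphism n u : comm_prod n u -> `|f u| <= 4 * n%:R.
Proof.
elim: n u => [|n IHn] u [[|[x y] s] [//= + ->]].
  move=> _; have := fV 1%g; rewrite big_nil invg1 mulr0 => f1.
  by have -> : f 1%g = 0; [lra | rewrite normr0 lexx].
move=> [sn]; rewrite big_cons /= commgEl conjgE.
have := IHn (\prod_(p <- s) [~ p.1, p.2])%g (ex_intro _ s (conj sn erefl)).
set w := (\prod_(_ <- _) _)%g.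
have := f_defect (x^-1 * (y^-1 * (x * y)))%g w.
have := f_defect x^-1%g (y^-1 * (x * y))%g.
have := f_defect y^-1%g (x * y)%g.
have := f_defect x y.
rewrite !fV !ler_norml -natr1; lra.
Qed.
End Quasimorphism.

Section SclLimit.
Variables (R : realType) (G : groupType).
Implicit Types g : G.
Local Open Scope classical_set_scope.
Local Open Scope ring_scope.

Lemma comm_prodX g c n : comm_prod c g -> comm_prod (n * c) (g ^+ n)%g.
Proof.
move=> gc; elim: n => [|n IHn]; first exact: comm_prod0.
by rewrite expgS mulSn; exact: comm_prodM.
Qed.

Lemma cl_le g n : comm_prod n g -> (cl g <= n)%N.
Proof.
move=> gn; rewrite /cl; case: pselect => [h|//].
by case: ex_minnP => k _ /(_ n); apply; apply/asboolP.
Qed.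

Lemma comm_prod_cl g : in_derived g -> comm_prod (cl g) g.
Proof.
case=> n gn; rewrite /cl; case: pselect => [h|[]].
  by case: ex_minnP => k /asboolP.
by exists n; apply/asboolP.
Qed.

(** The upper estimate is needed only along the multiples of N: the powers in
    between differ by a bounded power of an element of the derived subgroup. *)
Lemma scl_squeeze g (v C : R) (N : nat) (c : nat -> nat) :
  (0 < N)%N -> 0 <= v ->
  (forall n, comm_prod (c n) (g ^+ (N * n))%g) ->
  (forall n, (c n)%:R <= v * (N * n)%:R + C) ->
  (forall n k, (0 < n)%N -> comm_prod k (g ^+ n)%g -> v * n%:R <= k%:R + C) ->
  scl R g = v%:E.
Proof.
move=> N0 v0 gc cC lower; rewrite /scl; case: pselect => [h|[]]; last first.
  exists N; rewrite N0 /=; apply/asboolP; exists (c 1%N).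
  by have := gc 1%N; rewrite muln1.
case: ex_minnP => k /andP[k0 /asboolP[c0 gk]] _; congr (_ %:E).
suff : (fun n : nat => (cl ((g ^+ k) ^+ n)%g)%:R / n%:R : R) @ \oo --> v * k%:R.
  move/cvg_lim => /(_ (@Rhausdorff R)); rewrite /scl_derived => ->.
  by rewrite mulfK // pnatr_eq0 -lt0n.
have upper n : (cl ((g ^+ k) ^+ n)%g)%:R <= v * k%:R * n%:R + (C + (N * c0)%:R).
  have E : ((g ^+ k) ^+ n = g ^+ (N * (k * (n %/ N))) * (g ^+ k) ^+ (n %% N))%g.
    by rewrite -!expgnA -expgnDr; congr natexp; rewrite {1}(divn_eq n N); lia.
  have cn : (cl ((g ^+ k) ^+ n)%g <= c (k * (n %/ N))%N + n %% N * c0)%N.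
    by apply: cl_le; rewrite E; apply: comm_prodM (comm_prodX _ gk).
  have r1 : (cl ((g ^+ k) ^+ n)%g)%:R <= (c (k * (n %/ N))%N)%:R + (N * c0)%:R :> R.
    rewrite -natrD ler_nat (leq_trans cn) // leq_add2l leq_mul2r.
    by rewrite ltnW ?orbT // ltn_mod.
  apply: (le_trans r1); rewrite addrA lerD2r (le_trans (cC _)) // lerD2r.
  rewrite -mulrA ler_wpM2l // -natrM ler_nat.
  by rewrite mulnCA leq_mul2l mulnC leq_trunc_div orbT.
set C' := `|C| + (N * c0)%:R.
have C'0 : 0 <= C' by rewrite addr_ge0.
apply/cvgrPdist_le => e e0; near=> n.
have n0 : (0 < n)%N by near: n; exact: nbhs_infty_gt.
have n0' : 0 < n%:R :> R by rewrite ltr0n.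
have en : C' <= e * n%:R.
  rewrite -ler_pdivrMl //; near: n; exact: nbhs_infty_ger.
have low : v * k%:R * n%:R <= (cl ((g ^+ k) ^+ n)%g)%:R + C.
  rewrite -mulrA -natrM; apply: lower; first by rewrite muln_gt0 k0.
  by rewrite expgnA; apply: comm_prod_cl; exists (n * c0)%N; exact: comm_prodX.
have CC : C <= `|C| := ler_norm C.
have M0 : 0 <= (N * c0)%:R :> R by [].
have := upper n.
rewrite distrC ler_distl; set u := _%:R => up.
rewrite ler_pdivlMr // ler_pdivrMr // mulrBl mulrDl.
by rewrite /C' in en; apply/andP; split; lra.
Unshelve. all: by end_near.
Qed.
End SclLimit.

(** * The turning number on the Baumslag-Solitar group *)

Section Rotation.
Variables (R : realType) (m l cm cl : int).
Hypotheses (m_neq0 : m != 0%R) (l_neq0 : l != 0%R).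
Local Open Scope ring_scope.
Local Notation a := (BS_a m l).
Local Notation t := (BS_t m l).

Definition rot (g : BS m l) : R := turning R m l cm cl (gact g ([::], 0)).1.

Lemma rot_path k k' L : sorted (no_backtrack m l) L ->
  rot (expgz a k * eval_path m l L * expgz a k')%g = turning_path R m l cm cl L.
Proof.
move=> redL; rewrite /rot !gactM ?reduced_gact // gact_a ?reduced_gact //=.
by rewrite gact_eval_path ?reduced_gact // gact_a // turning_run_nil.
Qed.

Lemma rot_defect g h : `|rot (g * h)%g - rot g - rot h| <= 1.
Proof.
have [L [k [redL ->]]] := eval_path_reduced h.
have := rot_path 0 k redL; rewrite [expgz a 0]/= mul1g => ->.
rewrite /rot mulgA !gactM // gact_a ?reduced_gact //=.
rewrite gact_eval_path ?reduced_gact //.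
by case: (gact g _) => s k0; exact: turning_run_defect.
Qed.

(** Made odd so that commutators contribute only through the defect. *)
Definition rotation (g : BS m l) : R := (rot g - rot g^-1%g) / 2.

Lemma rotationV g : rotation g^-1%g = - rotation g.
Proof. by rewrite /rotation invgK; lra. Qed.

Lemma rotation_defect g h : `|rotation (g * h)%g - rotation g - rotation h| <= 1.
Proof.
have := rot_defect h^-1%g g^-1%g; have := rot_defect g h.
by rewrite /rotation invgM !ler_norml; lra.
Qed.

(** The reduced path of (a^j t a^i t^-1)^n. *)
Definition zigzag (i j : int) n := flatten (nseq n [:: (j, false); (i, true)]).

Lemma eval_zigzag i j n : eval_path m l (zigzag i j n) =
  ((expgz a j * t * expgz a i * t^-1) ^+ n)%g.
Proof.
elim: n => [|n IHn]; rewrite /eval_path; first by rewrite big_nil.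
by rewrite !big_cons -/(eval_path _ _ _) IHn expgS /= !mulgA.
Qed.

Lemma zigzag_reduced i j n : ~~ (m %| i)%Z -> ~~ (l %| j)%Z ->
  sorted (no_backtrack m l) (zigzag i j n).
Proof.
move=> mi lj.
have nb_t : no_backtrack m l (j, false) (i, true) by rewrite /no_backtrack.
have nb_a : no_backtrack m l (i, true) (j, false) by rewrite /no_backtrack.
by elim: n => // -[|n] /=; rewrite nb_t // nb_a.
Qed.

Lemma turning_zigzag i j n : turning_path R m l cm cl (zigzag i j n.+1) =
  n.+1%:R * sawtooth R m (cm * i) + n%:R * sawtooth R l (cl * j).
Proof.
elim: n => [|n IHn]; first by rewrite /= /turn /= mul0r !addr0 mul1r.
have -> : turning_path R m l cm cl (zigzag i j n.+2) =
    sawtooth R m (cm * i) + (sawtooth R l (cl * j)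
      + turning_path R m l cm cl (zigzag i j n.+1)) by [].
by rewrite IHn -[n.+2%:R]natr1 -[in X in _ = _ + X]natr1; ring.
Qed.

Variables (i j : int).
Hypotheses (mi : ~~ (m %| i)%Z) (lj : ~~ (l %| j)%Z).
Local Notation g := (t * expgz a i * t^-1 * expgz a j)%g.

Lemma rotation_exp n : rotation (g ^+ n.+1)%g =
  n.+1%:R * sawtooth R m (cm * i) + n%:R * sawtooth R l (cl * j).
Proof.
have gE : (g ^+ n.+1 = expgz a (- j) * eval_path m l (zigzag i j n.+1) * expgz a j)%g.
  have -> : g = ((expgz a j * t * expgz a i * t^-1) ^ expgz a j)%g.
    by rewrite conjgE !mulgA mulVg mul1g.
  by rewrite -conjXg conjgE eval_zigzag expgzN mulgA.
have gVE : (g ^- n.+1 = expgz a 0 * eval_path m l (zigzag (- i) (- j) n.+1) * expgz a 0)%g.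
  by rewrite eval_zigzag mul1g mulg1 -expVgn !invgM !expgzN !mulgA invgK.
rewrite /rotation gVE gE !rot_path ?zigzag_reduced //.
  rewrite !turning_zigzag.
  have sN M c k : M != 0 -> sawtooth R M (c * - k) = - sawtooth R M (c * k).
    move=> M0; have := @sawtooth_opp R M M0 (c * - k) (c * k).
    by rewrite mulrN addNr dvdz0 => /(_ isT) ?; lra.
  by rewrite !sN //; lra.
all: by rewrite rpredN.
Qed.
End Rotation.

(** * The upper bound in the Baumslag-Solitar group *)

Section BSUpperBound.
Variables (m l i j : int).
Hypotheses (m_neq0 : m != 0%R) (l_neq0 : l != 0%R).
Hypotheses (mi : ~~ (m %| i)%Z) (lj : ~~ (l %| j)%Z).
Local Notation a := (BS_a m l).
Local Notation t := (BS_t m l).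
Local Open Scope group_scope.

(** The order of k in the integers modulo M: the order of a cone point of the
    disc bounded by x y. *)
Definition cone_order (M k : int) : nat := (`|M| %/ gcdn `|k| `|M|)%N.

Lemma cone_order_gcd M k : (cone_order M k * gcdn `|k| `|M| = `|M|)%N.
Proof. by rewrite divnK // dvdn_gcdr. Qed.

Lemma cone_order_gt1 M k : M != 0%R -> ~~ (M %| k)%Z -> 1 < cone_order M k.
Proof.
move=> M0 Mk; have := cone_order_gcd M k; move: (cone_order M k) => p pE.
case: p pE => [|[|p]] // pE; first by move: M0; rewrite -absz_eq0 -pE eqxx.
by move: Mk; rewrite dvdzE -pE mul1n dvdn_gcdl.
Qed.

Lemma cone_order_dvd M k : (M %| (k * (cone_order M k)%:Z)%R)%Z.
Proof.
rewrite dvdzE abszM absz_nat; have [d kE] := dvdnP (dvdn_gcdl `|k| `|M|).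
by rewrite kE -mulnA [(gcdn _ _ * _)%N]mulnC cone_order_gcd dvdn_mull.
Qed.

Lemma BS_conj_exp r : t * expgz a (m * r)%R * t^-1 = expgz a (l * r)%R.
Proof. by have := BS_modulus m l false r; rewrite /= => <-; rewrite mulgK. Qed.

(** Conjugation by t turns a^(m r) into a^(l r). *)
Lemma BS_comm_exp r : comm_prod 1 (expgz a ((l - m) * r)%R).
Proof.
have -> : expgz a ((l - m) * r)%R = [~ t^-1, expgz a (- (m * r))%R].
  rewrite commgEl conjgE invgK -expgzN opprK !mulgA.
  by rewrite BS_conj_exp mulrBl expgzD.
exact: comm_prodR.
Qed.

Let p := cone_order m i.
Let q := cone_order l j.
Let K := (p * q - p - q)%N.

Lemma BS_upper n :
  comm_prod (K * (`|l - m| * n)./2 + K.+2)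
    ((t * expgz a i * t^-1 * expgz a j) ^+ (p * q * (`|l - m| * n))).
Proof.
set x := t * expgz a i * t^-1; set y := expgz a j.
have xE : x = expgz a i ^ t^-1 by rewrite conjgE invgK mulgA.
have [r rE] := dvdzP (cone_order_dvd m i).
have [s sE] := dvdzP (cone_order_dvd l j).
have xpE : x ^+ p = expgz a (l * r)%R.
  by rewrite xE -conjXg expgz_exp rE mulrC conjgE invgK mulgA BS_conj_exp.
have yqE : y ^+ q = expgz a (l * s)%R by rewrite expgz_exp sE mulrC.
have xpy : commute (x ^+ p) y.
  by rewrite /commute xpE -!expgzD addrC.
have yqx : commute (y ^+ q) x.
  rewrite /commute yqE -BS_conj_exp /x !mulgA !mulgVK.
  by rewrite -!(mulgA t) -!expgzD addrC.
have := near_exp_mul_central xpy yqx (cone_order_gt1 m_neq0 mi)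
  (cone_order_gt1 l_neq0 lj) (`|l - m| * n)%N.
rewrite -/p -/q -/K /near_mod; set u := _ ^+ (p * q * _); set z := _ ^+ (_ * n)%N.
have zE : comm_prod 1 z.
  rewrite /z expgnA [(p * q)%N]mulnC [y ^+ _]expgnA yqE [(q * p)%N]mulnC expgnA xpE.
  rewrite !expgz_exp -expgzD -expgnA expgz_exp.
  set w := (_ + _)%R.
  have /dvdzP[w' ->] : ((l - m)%R %| (w * (`|l - m| * n)%N%:Z)%R)%Z.
    by rewrite dvdz_mull // dvdzE absz_nat dvdn_mulr.
  by rewrite mulrC; exact: BS_comm_exp.
move=> uz; rewrite -[u](mulgK z) addnS -addn1.
have -> : u * z * z^-1 = z * (u^-1 * z)^-1.
  by rewrite invgM invgK !mulgA mulgV mul1g mulgK.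
by rewrite addnC; apply: comm_prodM (comm_prodV uz).
Qed.
End BSUpperBound.

(** * The extremal slope and the conclusion *)

Section BSLowerBound.
Variable R : realType.
Local Open Scope ring_scope.

(** A Bezout coefficient c turns k into gcd(k, M), the least positive residue
    in the subgroup that k generates, where the sawtooth is largest. *)
Lemma sawtooth_bezout (M k : int) : M != 0 -> ~~ (M %| k)%Z ->
  exists c, sawtooth R M (c * k) = 1 - 2 * ((gcdz k M)%:~R / `|M|%:~R).
Proof.
move=> M0 Mk; have [c [c' cE]] := Bezoutz k M; exists c.
have gcd_neq0 : gcdz k M != 0 by rewrite gcdz_eq0 (negPf M0) andbF.
have gcd_range : 0 <= gcdz k M < `|M|.
  rewrite lt_neqAle /=; apply/andP; split; last first.
    by rewrite -abszE lez_nat dvdn_leq ?absz_gt0 ?dvdn_gcdr.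
  by apply: contra Mk => /eqP gM; have := dvdz_gcdl k M; rewrite gM dvdzE absz_nat.
rewrite /sawtooth (@modz_uniq M _ (gcdz k M)) ?(negPf gcd_neq0) //.
by rewrite -cE opprD addrA subrr sub0r rpredN dvdz_mull.
Qed.
End BSLowerBound.

Theorem proposition5p5 (R : realType) (m l i j : int)
    (hm : m != 0%R) (hl : l != 0%R) (hml : m != l)
    (hi : ~~ (m %| i)%Z) (hj : ~~ (l %| j)%Z) :
  let a := BS_a m l in
  let t := BS_t m l in
  scl R (t * expgz a i * t^-1 * expgz a j)%g =
  (1 / 2 * (1 - (gcdz i m)%:~R / `|m|%:~R - (gcdz j l)%:~R / `|l|%:~R))%R%:E.
Proof.
move=> a t; set g := (t * _ * _ * _)%g; set v := (_ * _)%R.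
have ratioE (M k : int) : M != 0%R ->
    ((gcdz k M)%:~R / `|M|%:~R = (cone_order M k)%:R^-1 :> R)%R.
  move=> M0; rewrite -abszE -{1}(cone_order_gcd M k) /gcdz -!pmulrn natrM invfM.
  by rewrite mulrCA divff ?mulr1 // pnatr_eq0 -lt0n gcdn_gt0 !absz_gt0 M0 orbT.
set p := cone_order m i; set q := cone_order l j.
have p1 : (1 < p)%N := cone_order_gt1 hm hi.
have q1 : (1 < q)%N := cone_order_gt1 hl hj.
set K := (p * q - p - q)%N; set D := `|(l - m)%R|%N.
have D0 : (0 < D)%N by rewrite absz_gt0 subr_eq0 eq_sym.
have pq0 : (0 < p * q)%N by rewrite muln_gt0 (ltnW p1) (ltnW q1).
have P0 : (p%:R != 0 :> R)%R by rewrite pnatr_eq0 -lt0n ltnW.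
have Q0 : (q%:R != 0 :> R)%R by rewrite pnatr_eq0 -lt0n ltnW.
have vE : (2 * (p * q)%:R * v = K%:R)%R.
  rewrite /v !ratioE // -/p -/q /K -subnDA natrB; last by nia.
  by rewrite natrD natrM; field; rewrite P0 Q0.
have [cm cmE] := sawtooth_bezout R hm hi.
have [cl clE] := sawtooth_bezout R hl hj.
have pq0' : (0 < (p * q)%:R :> R)%R by rewrite ltr0n.
have v0 : (0 <= v)%R.
  have : (0 <= 2 * (p * q)%:R * v)%R by rewrite vE.
  by rewrite pmulr_rge0 // mulr_gt0.
(* K.+2 also dominates the constant 1/4 lost in the lower estimate. *)
apply: (@scl_squeeze R _ g v (K.+2)%:R (p * q * D)
  (fun n => K * (D * n)./2 + K.+2)%N) => //.
- by rewrite muln_gt0 pq0.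
- by move=> n; rewrite -mulnA; exact: BS_upper.
- move=> n; rewrite natrD lerD2r -mulnA natrM.
  have half : (2 * ((D * n)./2)%:R <= (D * n)%:R :> R)%R.
    by rewrite -natrM ler_nat mul2n -[leqRHS]odd_double_half leq_addl.
  have : (2 * (p * q)%:R * v * (2 * ((D * n)./2)%:R) <=
          2 * (p * q)%:R * v * (D * n)%:R)%R.
    by rewrite ler_wpM2l // vE.
  by rewrite {1}vE natrM [((p * q * _)%N%:R)%R]natrM; lra.
- move=> [//|n] k _ gk.
  have := comm_prod_quasimorphism (rotationV R cm cl)
    (rotation_defect R cm cl hm hl) gk.
  rewrite rotation_exp // cmE clE ler_norml => /andP[_].
  have : (1 <= K.+2%:R :> R)%R by rewrite ler1n.
  rewrite -[(n.+1%:R)%R]natr1 /v !ratioE //; set P := (p%:R^-1)%R; set Q := (q%:R^-1)%R.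
  have Q_ge0 : (0 <= Q)%R by rewrite invr_ge0.
  lra.
Qed.
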